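(* For each $n\ge1$, $$|\mathcal{R}_{n+1}(12321)|=\sum_{k=0}^n\binom{n}{k}\mathfrak{c}_k,$$ where $\mathfrak{c}_k=\frac{1}{k+1}\binom{2k}{k}$ is the $k$-th Catalan number. Moreover, there are $$\sum_{j=k}^{n}\binom{n}{j}\mathfrak{n}_{j,k}$$ restricted growth functions in $\mathcal{R}_{n+1}(12321)$ with maximum $k+1$, where $\mathfrak{n}_{j,k}$ is the $(j,k)$-th Narayana number.
   Context: A restricted growth function (RGF) of length $n$ is a sequence of positive integers $r_1\cdots r_n$ with $r_1=1$ and $r_i\le 1+\max\{r_1,\dots,r_{i-1}\}$ for $i\ge2$. The standardization $\mathrm{std}(Q)$ of an integer sequence replaces all occurrences of its $i$-th smallest distinct value by $i$, for all $i$. An RGF $R$ contains $Q$ if some subsequence of $R$ has standardization equal to $Q$; otherwise it avoids $Q$. $\mathcal{R}_n(Q)$ is the set of RGFs of length $n$ avoiding $Q$. The Narayana numbers are $\mathfrak{n}_{j,k}=\frac1j\binom{j}{k}\binom{j}{k-1}$ for $1\le k\le j$, with the conventions $\mathfrak{n}_{0,0}=1$ and $\mathfrak{n}_{j,0}=0$ for $j\ge1$. Here $0\le k\le n$. *)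

(* Defs.v *)
From mathcomp Require Import all_boot.
Set Implicit Arguments.
Unset Strict Implicit.
Unset Printing Implicit Defensive.

(* Sequences are indexed from 0, so [r`_0] is the letter r_1 and [take i r] is
   the part of r strictly before position i. *)
Definition is_rgf (r : seq nat) : bool :=
  [&& all (leq 1) r,
      nth 0 r 0 == 1 &
      all (fun i => nth 0 r i <= 1 + \max_(x <- take i r) x)
          (iota 1 (size r).-1)].

Definition std (s : seq nat) : seq nat :=
  [seq (index x (sort leq (undup s))).+1 | x <- s].

(* The subsequences of r are its images under the bit masks of length size r. *)
Definition contains (r q : seq nat) : bool :=
  [exists m : (size r).-tuple bool, std (mask m r) == q].

Definition avoids (r q : seq nat) : bool := ~~ contains r q.

Definition word m (w : m.-tuple 'I_m.+1) : seq nat := map val w.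

(* The letters of an RGF of length m are at most m, so words over 'I_m.+1 lose
   nothing; see rgf_avoidingP. *)
Definition rgf_avoiding (m : nat) (q : seq nat) : {set m.-tuple 'I_m.+1} :=
  [set w | is_rgf (word w) && avoids (word w) q].

Definition maxletter (r : seq nat) : nat := \max_(x <- r) x.

(* The quotients in catalan and narayana are exact; see catalanE, narayanaE. *)
Definition catalan (k : nat) : nat := 'C(2 * k, k) %/ k.+1.

Definition narayana (j k : nat) : nat :=
  if k is k'.+1 then ('C(j, k'.+1) * 'C(j, k')) %/ j else j == 0.

Lemma rgf_letter_le r x : is_rgf r -> x \in r -> x <= size r.
Proof.
case/and3P=> _ /eqP r0 /allP H.
have B: forall i, i <= size r -> \max_(y <- take i r) y <= i.
  elim=> [|i IH] lei; first by rewrite take0 big_nil.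
  have IHi := IH (ltnW lei).
  rewrite (take_nth 0) // -cats1 big_cat big_seq1 /= geq_max (leqW IHi) /=.
  case: i IH lei IHi => [|i] IH lei IHi; first by rewrite r0.
  apply: leq_trans (H i.+1 _) _; last by rewrite add1n ltnS.
  by rewrite mem_iota add1n /= prednK // (leq_trans _ lei).
move=> xr; have := B _ (leqnn _); rewrite take_size; apply: leq_trans.
exact: (@leq_bigmax_seq _ r xpredT id x xr isT).
Qed.

Lemma word_inj m : injective (@word m).
Proof. by move=> u v /(inj_map val_inj) /val_inj. Qed.

Lemma rgf_avoidingP m q r :
  reflect (exists2 w, w \in rgf_avoiding m q & word w = r)
          [&& size r == m, is_rgf r & avoids r q].
Proof.
apply: (iffP idP) => [/and3P[/eqP sr R A]|[w]]; last first.
  by rewrite inE => /andP[R A] <-; rewrite R A size_map size_tuple eqxx.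
have sw : size (map (@inord m) r) == m by rewrite size_map sr.
have E : word (Tuple sw) = r.
  rewrite /word /= -map_comp -[RHS]map_id; apply/eq_in_map => x xr /=.
  by rewrite inordK // ltnS -sr rgf_letter_le.
by exists (Tuple sw); rewrite ?inE E ?R.
Qed.

Lemma catalanE k : catalan k * k.+1 = 'C(2 * k, k).
Proof.
apply: divnK; have e := mul_bin_left (2 * k) k.
have ck : coprime k.+1 k by rewrite coprimeSn.
rewrite -(Gauss_dvdr _ ck); move: e.
by rewrite mul2n -addnn addnK => <-; apply: dvdn_mulr.
Qed.

Lemma narayanaE j k : 0 < k -> narayana j k * j = 'C(j, k) * 'C(j, k.-1).
Proof.
case: k => // k _ /=; case: j => [|j]; first by rewrite bin0n muln0.
apply: divnK; set N := _ * _.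
have d1 : j.+1 %| k.+1 * N.
  by rewrite /N mulnA -mul_bin_diag -mulnA dvdn_mulr.
have d2 : j.+1 %| k * N.
  rewrite /N; case: k {d1 N} => [|k]; first by rewrite mul0n.
  by rewrite mulnCA -mul_bin_diag mulnCA dvdn_mulr.
by rewrite -(dvdn_addr N d2) addnC -mulSn.
Qed.

(* Main.v *)
Require Import Defs.
From mathcomp Require Import all_boot.
From mathcomp Require Import zify.
Set Implicit Arguments.
Unset Strict Implicit.
Unset Printing Implicit Defensive.

(** In a restricted growth function every positive value smaller than a letter c
    occurs before c, and the first occurrences are in increasing order.  Hence
    a strict descent c > b > a extends to the left to an occurrence of
    a b c b a, and avoiding 12321 is the same as avoiding 321
    ([rgf_contains_12321]).

    A word avoids 321 when the letters lying below the running maximum are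
    weakly increasing.  So, reading an RGF from left to right, it is enough to
    remember the running maximum m and the last letter l that was below it
    (l = 1 at the start): the next letter x may be anything with
    l <= x <= m + 1 ([rgf_avoids_12321]).  With d = m - l, the choice x = m
    keeps d, the choice x = m + 1 raises d by one, and the other choices reach
    each of the values 1, ..., d exactly once.  The n letters after the initial
    1 are therefore given by the set of the j positions where x <> m, whence the
    factor 'C(n, j), and by a sequence of j moves of the two other kinds
    ([count_continuations]).

    The number of sequences of j moves with k ascents satisfies a recursion
    whose solution is a two by two determinant of binomials ([movesE]), as for
    pairs of non-crossing lattice paths; from d = 0 it is a Narayana number
    ([moves_narayana]).  Since k ascents give the maximum k + 1, this is the
    count by maximum.  Summing over k, the Narayana numbers add up to a Catalan
    number by Vandermonde's identity ([sum_narayana]). *)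

(** * Letters of restricted growth functions *)

Lemma maxletter_rcons r x : maxletter (rcons r x) = maxn (maxletter r) x.
Proof. by rewrite /maxletter -cats1 big_cat big_seq1. Qed.

Lemma maxletter_leq r x : (maxletter r <= x) = all (leq^~ x) r.
Proof.
rewrite /maxletter; elim: r => [|y r IH]; rewrite ?big_nil //.
by rewrite big_cons geq_max IH.
Qed.

Lemma maxletter_foldl r m : foldl maxn m r = maxn m (maxletter r).
Proof.
rewrite /maxletter; elim: r m => [|x r IH] m /=; first by rewrite big_nil maxn0.
by rewrite IH big_cons maxnA.
Qed.

Lemma is_rgf_rcons p x : p != [::] ->
  is_rgf (rcons p x) = is_rgf p && (0 < x <= (maxletter p).+1).
Proof.
case: p => // y p _; rewrite /is_rgf all_rcons size_rcons.
rewrite [size (y :: p)]/= [_.+2.-1]/= -[(size p).+1]addn1 iotaD all_cat /=.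
rewrite !add1n nth_rcons /= ltnn eqxx -cats1 take_size_cat // andbT.
rewrite cats1 andbA -/(maxletter (y :: p)).
have -> : all (fun i => nth 0 (y :: rcons p x) i <=
    1 + \max_(z <- take i (y :: rcons p x)) z) (iota 1 (size p)) =
  all (fun i => nth 0 (y :: p) i <= 1 + \max_(z <- take i (y :: p)) z)
    (iota 1 (size p)).
  apply: eq_in_all => i; rewrite mem_iota add1n => /andP[_ lti].
  by rewrite -rcons_cons nth_rcons [size _]/= lti -cats1 takel_cat // ltnW.
rewrite addn1 [_.+1.-1]/=.
by do 2!case: (0 < _) => //=; rewrite ?andbF //= -!andbA.
Qed.

Lemma is_rgf_catl p q : p != [::] -> is_rgf (p ++ q) -> is_rgf p.
Proof.
move=> p0; elim/last_ind: q => [|q x IH]; first by rewrite cats0.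
rewrite -rcons_cat is_rgf_rcons; first by case/andP=> /IH.
by case: p p0 {IH}.
Qed.

Lemma rgf_letters r b : is_rgf r -> 0 < b <= maxletter r -> b \in r.
Proof.
elim/last_ind: r => [|r x IH]; first by [].
have [->|r0] := eqVneq r [::].
  case/and3P=> _ /= /eqP-> _; rewrite /maxletter big_seq1 inE; lia.
rewrite is_rgf_rcons // maxletter_rcons mem_rcons inE => /andP[R xb] bm.
have [bm'|] := leqP b (maxletter r); last by lia.
by rewrite IH ?orbT //; lia.
Qed.

Lemma rgf_smaller_before p c q b :
  is_rgf (p ++ c :: q) -> 0 < b < c -> b \in p.
Proof.
have [->|p0] := eqVneq p [::]; first by case/and3P=> _ /= /eqP-> _; lia.
rewrite -cat_rcons => /is_rgf_catl.
rewrite -size_eq0 size_rcons is_rgf_rcons // => /(_ isT)/andP[R xb] bc.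
apply: rgf_letters => //; lia.
Qed.

Lemma rgf_gt0 r x : is_rgf r -> x \in r -> 0 < x.
Proof. by case/and3P=> /allP H _ _ /H. Qed.

(** * Avoiding 12321 is avoiding 321 *)

Definition three_descent (r : seq nat) : Prop :=
  exists c b a, [/\ a < b, b < c & subseq [:: c; b; a] r].

Lemma std_12321 a b c : a < b -> b < c ->
  std [:: a; b; c; b; a] = [:: 1; 2; 3; 2; 1].
Proof.
move=> ab bc; rewrite /std.
have -> : sort leq (undup [:: a; b; c; b; a]) = [:: a; b; c].
  have -> : undup [:: a; b; c; b; a] = [:: c; b; a].
    rewrite /= !inE; have -> : (b == a) = false by lia.
    have -> : (c == b) = false by lia.
    have -> : (c == a) = false by lia.
    by rewrite !eqxx /= !orbT.
  have -> : sort leq [:: c; b; a] = sort leq [:: a; b; c].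
    apply/(perm_sortP leq_total leq_trans anti_leq).
    by rewrite -(perm_rev [:: c; b; a]).
  by apply: (sorted_sort leq_trans); rewrite /= (ltnW ab) (ltnW bc).
rewrite /= !eqxx; have -> : (a == b) = false by lia.
have -> : (a == c) = false by lia.
by have -> : (b == c) = false by lia.
Qed.

Lemma std_ltn s i j : i < size s -> j < size s ->
  nth 0 (std s) i < nth 0 (std s) j -> nth 0 s i < nth 0 s j.
Proof.
move=> si sj; rewrite /std !(nth_map 0) // ltnS.
apply: (sorted_ltn_index ltn_trans); rewrite ?mem_sort ?mem_undup ?mem_nth //.
rewrite ltn_sorted_uniq_leq sort_uniq undup_uniq.
exact: (sort_sorted leq_total).
Qed.

Lemma containsP r q :
  reflect (exists2 t, subseq t r & std t = q) (contains r q).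
Proof.
apply: (iffP existsP) => [[m /eqP <-]|[t /subseqP[m sm ->] <-]].
  by exists (mask m r); rewrite ?mask_subseq.
by exists (Tuple (introT eqP sm)).
Qed.

(** The letters 3, 2, 1 at the end of the pattern give the descent.  Conversely,
    given c > b > a, the value b occurs before c and the value a before that
    occurrence of b. *)
Lemma rgf_contains_12321 r : is_rgf r ->
  contains r [:: 1; 2; 3; 2; 1] <-> three_descent r.
Proof.
move=> R; split=> [/containsP[t tr E]|[c [b [a [ab bc sr]]]]].
  have st : size t = 5 by rewrite -[5]/(size [:: 1; 2; 3; 2; 1]) -E size_map.
  exists (nth 0 t 2), (nth 0 t 3), (nth 0 t 4).
  split; try by apply: std_ltn; rewrite ?st ?E.
  apply: subseq_trans tr; case: t st {E} => [|x0[|x1[|x2[|x3[|x4[|]]]]]] // _.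
  exact: (suffix_subseq [:: x0; x1]).
apply/containsP; exists [:: a; b; c; b; a]; last exact: std_12321.
have cr : c \in r by apply: (mem_subseq sr); rewrite !inE eqxx.
have a0 : 0 < a.
  by apply: (rgf_gt0 R); apply: (mem_subseq sr); rewrite !inE eqxx !orbT.
have [p [q [rE sq]]] : exists p q, r = p ++ c :: q /\ subseq [:: b; a] q.
  elim: r sr {R cr} => //= x r IH; case: eqP => [->|_] s.
    by exists [::], r.
  by have [p [q [-> sq]]] := IH s; exists (x :: p), q.
have bp : b \in p.
  by apply: (rgf_smaller_before (c := c) (q := q)); rewrite -?rE //; lia.
rewrite rE -[X in subseq X _]/([:: a; b] ++ [:: c; b; a]).
apply: cat_subseq; last by rewrite /= eqxx.
case/splitPr: bp rE => p1 p2 rE.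
rewrite -[X in subseq X _]/([:: a] ++ [:: b]).
apply: cat_subseq; last by rewrite /= eqxx sub0seq.
rewrite sub1seq.
apply: (rgf_smaller_before (c := b) (q := p2 ++ c :: q)); last by lia.
by rewrite -cat_cons catA -rE.
Qed.

Lemma subseq_rcons_rcons (t : seq nat) a p x :
  subseq (rcons t a) (rcons p x) =
  if a == x then subseq t p else subseq (rcons t a) p.
Proof.
rewrite -subseq_rev !rev_rcons [LHS]/=.
by case: ifP; rewrite -?rev_rcons subseq_rev.
Qed.

(** * The state of a 321-avoiding word *)

(** The largest b that is the lower letter of some descent y > b in p, or 1 if
    there is no descent.  It is specified through the z below it, the bounds
    that matter when a letter z is appended; [0 < z] then allows the value 1 in
    the absence of descents. *)
Definition descent_level (p : seq nat) (l : nat) : Prop :=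
  forall z, 0 < z ->
    z < l <-> exists y b, [/\ z < b, b < y & subseq [:: y; b] p].

Lemma three_descent_rcons p l x : descent_level p l -> 0 < x ->
  three_descent (rcons p x) <-> three_descent p \/ x < l.
Proof.
move=> lp x0; split=> [[c [b [a [ab bc]]]]|].
  rewrite (subseq_rcons_rcons [:: c; b]); case: eqP => [ax|_] s.
    by right; apply/lp => //; exists c, b; rewrite -ax.
  by left; exists c, b, a.
case=> [[c [b [a [ab bc s]]]]|/lp[] // c [b [xb bc s]]].
  by exists c, b, a; split=> //; apply: subseq_trans s (subseq_rcons _ _).
by exists c, b, x; split=> //; rewrite (subseq_rcons_rcons [:: c; b]) eqxx.
Qed.

(** A letter below the maximum ends a descent, and being at least l it becomes
    the new largest lower letter; any other letter ends no descent. *)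
Lemma descent_level_rcons p l x : descent_level p l -> l <= x ->
  descent_level (rcons p x) (if x < maxletter p then x else l).
Proof.
move=> lp lx z z0; split.
  case: ifP => [|_ zl].
    rewrite ltnNge maxletter_leq => /allPn[y yp]; rewrite -ltnNge => xy zx.
    exists y, x; split=> //.
    by rewrite (subseq_rcons_rcons [:: y]) eqxx sub1seq.
  have /lp[] // := zl => y [b [zb lby s]]; exists y, b; split=> //.
  exact: subseq_trans s (subseq_rcons _ _).
case=> y [b [zb lby]]; rewrite (subseq_rcons_rcons [:: y]).
case: eqP => [bx|_ s].
  rewrite sub1seq => yp; suff -> : x < maxletter p by rewrite -bx.
  rewrite -bx; apply: leq_trans lby _.
  by have /allP/(_ _ yp) : all (leq^~ (maxletter p)) p by rewrite -maxletter_leq.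
have zl : z < l by apply/lp => //; exists y, b.
by case: ifP => // _; apply: leq_trans lx.
Qed.

(** The state is the maximum m and the descent level l of the letters already
    read; x >= l avoids 321 and x <= m + 1 is the growth condition. *)
Fixpoint admissible (m l : nat) (s : seq nat) : bool :=
  if s is x :: s' then
    (l <= x <= m.+1) && admissible (maxn m x) (if x < m then x else l) s'
  else true.

(** Admissibility of s is stated after an arbitrary prefix p, so that each letter
    of s in turn can be moved to the prefix. *)
Lemma admissible_catP s p l :
  p != [::] -> is_rgf p -> ~ three_descent p -> 0 < l -> descent_level p l ->
  admissible (maxletter p) l s <-> is_rgf (p ++ s) /\ ~ three_descent (p ++ s).
Proof.
elim: s p l => [|x s IH] p l p0 R D l0 lp; first by rewrite cats0.
have px0 : rcons p x != [::] by rewrite -size_eq0 size_rcons.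
rewrite -cat_rcons /= -maxletter_rcons; split.
  case/andP=> xb; set l' := (if _ then _ else _) => g.
  apply/(IH _ l') => //; rewrite /l' {l' g}.
  - by rewrite is_rgf_rcons // R; lia.
  - by rewrite (three_descent_rcons lp); [case=> // | ]; lia.
  - by case: ifP; lia.
  - by apply: descent_level_rcons => //; lia.
case=> R' D'; have := is_rgf_catl px0 R'.
rewrite is_rgf_rcons // => /andP[_ xb].
have lx : l <= x.
  rewrite leqNgt; apply/negP => xl; apply: D'.
  have [|c [b [a [ab bc s']]]] := (three_descent_rcons lp _).2 (or_intror xl).
    by lia.
  by exists c, b, a; split=> //; apply: subseq_trans s' (prefix_subseq _ _).
apply/andP; split; first lia.
apply/(IH (rcons p x)) => //.
- by rewrite is_rgf_rcons // R.
- by rewrite (three_descent_rcons lp); [case=> // | ]; lia.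
- by case: ifP; lia.
- exact: descent_level_rcons.
Qed.

Lemma rgf_avoids_12321 r :
  is_rgf r && avoids r [:: 1; 2; 3; 2; 1] =
  if r is x :: s then (x == 1) && admissible 1 1 s else false.
Proof.
case: r => // x s; have [->|x1] := eqVneq x 1; last first.
  by rewrite /is_rgf /= (negPf x1) /= andbF.
have D1 (t : seq nat) y z : ~ subseq [:: y, z & t] [:: 1].
  by move/size_subseq.
have H : admissible 1 1 s <-> is_rgf (1 :: s) /\ ~ three_descent (1 :: s).
  have := @admissible_catP s [:: 1] 1; rewrite {1}/maxletter big_seq1.
  apply=> //.
  - by case=> c [b [a [_ _ /D1]]].
  - by move=> z z0; split=> [|[y [b [_ _ /D1]]]] //; lia.
apply/andP/idP => [[R /negP A]|/H[R D]].
  by apply/H; split=> // /(rgf_contains_12321 R).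
by split=> //; apply/negP => /(rgf_contains_12321 R).
Qed.

(** * Counting the continuations of a state *)

Fixpoint continuations (n m l : nat) : seq (seq nat) :=
  if n is n'.+1 then
    [seq x :: s | x <- iota l (m.+2 - l),
                  s <- continuations n' (maxn m x) (if x < m then x else l)]
  else [:: [::]].

Lemma mem_continuations n m l s :
  (s \in continuations n m l) = (size s == n) && admissible m l s.
Proof.
elim: n m l s => [|n IH] m l s; first by case: s.
apply/allpairsPdep/idP => [[x [t [xi tw ->]]]|].
  move: xi tw; rewrite mem_iota IH => xi /andP[/eqP <- /= ->].
  by rewrite eqxx andbT /=; lia.
case: s => //= x s /and3P[sn xb g]; exists x, s; split=> //.
  by rewrite mem_iota; lia.
by rewrite IH g andbT.
Qed.

Lemma continuations_uniq n m l : uniq (continuations n m l).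
Proof.
elim: n m l => //= n IH m l; apply: allpairs_uniq_dep => //.
  exact: iota_uniq.
by case=> [x s] [y t] _ _ /= [-> ->].
Qed.

(** The number of sequences of j moves with k ascents from d = m - l, where an
    ascent is a new maximum and a letter x with l <= x < m leads to
    d = m - x, which is some i.+1 with i < d. *)
Fixpoint moves (j k d : nat) : nat :=
  if j is j'.+1 then
    (if k is k'.+1 then moves j' k' d.+1 else 0)
      + \sum_(0 <= i < d) moves j' k i.+1
  else k == 0.

(** Pascal's rule: of n.+1 letters, the first one repeats the maximum or
    makes a move. *)
Lemma binomial_sumS n (F : nat -> nat) :
  \sum_(0 <= j < n.+2) 'C(n.+1, j) * F j
  = \sum_(0 <= j < n.+1) 'C(n, j) * F j
    + \sum_(0 <= j < n.+1) 'C(n, j) * F j.+1.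
Proof.
rewrite big_nat_recl // bin0.
under eq_bigr => j _ do rewrite binS mulnDl.
rewrite big_split /= addnA; congr (_ + _).
rewrite [RHS]big_nat_recl // bin0 [in LHS]big_nat_recr //=.
by rewrite bin_small // mul0n addn0.
Qed.

Lemma count_continuations n k l d :
  count (fun s => foldl maxn (l + d) s == l + d + k) (continuations n (l + d) l)
  = \sum_(0 <= j < n.+1) 'C(n, j) * moves j k d.
Proof.
elim: n k l d => [|n IH] k l d.
  by rewrite big_nat1 bin0 mul1n /= addn0 -{1}[l + d]addn0 eqn_add2l eq_sym.
rewrite binomial_sumS /= count_flatten -map_comp sumnE big_map.
(* The three summands are the letters x < m, x = m and x = m + 1. *)
have -> : (l + d).+2 - l = d + 2 by lia.
rewrite iotaD big_cat /= big_cons big_seq1 /= !count_map.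
rewrite !maxnn ltnn maxnE (_ : _ + (_ - _) = (l + d).+1); last by lia.
rewrite (_ : _.+1 < _ = false); last by lia.
rewrite /preim /= [X in _ + (X + _)](_ : _ =
  \sum_(0 <= j < n.+1) 'C(n, j) * moves j k d); last first.
  by rewrite -(IH k l); apply: eq_count => s /=; rewrite maxnn.
rewrite addnCA; congr (_ + _).
under [in RHS]eq_bigr => j _ do rewrite mulnDr.
rewrite big_split /= addnC; congr (_ + _).
  case: k => [|k].
    rewrite [RHS]big1 => [|j _]; last by rewrite muln0.
    apply/eqP; rewrite -leqn0 leqNgt -has_count; apply/hasPn => s _ /=.
    rewrite maxletter_foldl; lia.
  rewrite -(IH k l d.+1) !addnS addSn; apply: eq_count => s /=.
  by rewrite (maxn_idPr (leqnSn _)).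
under [in RHS]eq_bigr => j _ do rewrite big_distrr.
(* The letters increase while the values d = m - x decrease. *)
rewrite exchange_big /= big_nat_rev /=.
rewrite -{1}[l]addn0 iotaDl big_map /index_iota subn0.
apply: eq_big_seq => i; rewrite mem_iota => /andP[_ lti].
rewrite count_map add0n (_ : (d - i.+1).+1 = d - i); last by lia.
rewrite -(IH k (l + i)) (_ : l + i + (d - i) = l + d); last by lia.
have lid : l + i < l + d by lia.
rewrite lid (maxn_idPl (ltnW lid)).
by apply: eq_count => s /=; rewrite (maxn_idPl (ltnW lid)).
Qed.

(** * Closed form for the numbers of moves *)

(** The binomial 'C(j, k - 1) with the value 0 at k = 0, which truncated
    subtraction would turn into 1. *)
Definition bin_pred (j k : nat) : nat := if k is k'.+1 then 'C(j, k') else 0.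

Lemma bin_predS j k : bin_pred j.+1 k.+1 = bin_pred j k.+1 + bin_pred j k.
Proof. by case: k => [|k]; rewrite /= ?bin0 // binS. Qed.

(** The subtraction-free form of a two by two determinant of binomials.  The
    moves from e.+1 and from e.+2 differ only in their ascents and in the single
    letter leading to e.+2; this difference equation is Pascal's rule for the
    closed form. *)
Lemma movesE j k e :
  moves j k e.+1 + bin_pred j k * 'C(j + e, (k + e).+1)
  = 'C(j, k) * 'C(j + e, k + e).
Proof.
elim: j k e => [|j IH] k e.
  case: k => [|k]; first by rewrite /= !add0n !binn.
  by rewrite (@bin_small (0 + e)) ?muln0 ?bin0n //; lia.
have S i : moves j.+1 k i.+1
    = (if k is k'.+1 then moves j k' i.+2 else 0)
      + \sum_(0 <= i' < i.+1) moves j k i'.+1 by [].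
elim: e => [|e IHe].
  rewrite S big_nat1 !addn0; have := IH k 0; rewrite !addn0.
  case: k {S} => [|k]; first by rewrite /= !bin0; lia.
  have := IH k 1; rewrite !addn1 bin_predS.
  rewrite /= !(binS j k.+1) !(binS j k); nia.
have SS : moves j.+1 k e.+2 + (if k is k'.+1 then moves j k' e.+2 else 0)
   = moves j.+1 k e.+1 + (if k is k'.+1 then moves j k' e.+3 else 0)
     + moves j k e.+2.
  by rewrite !S [X in _ + X + _]big_nat_recr //=; lia.
move: SS IHe; have := IH k e.+1; rewrite !addnS !addSn.
case: k {S} => [|k].
  by rewrite /= !bin0 !add0n (binS (j + e).+1 e); lia.
have := IH k e.+1; have := IH k e.+2; rewrite bin_predS !addnS !addSn.
rewrite (_ : bin_pred j k.+1 = 'C(j, k)) // (binS j k).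
rewrite (binS (j + e).+1 (k + e).+2) (binS (j + e).+1 (k + e).+1); nia.
Qed.

(** * Narayana and Catalan numbers *)

(** From d = 0 the first move has to be an ascent, so for positive j and k this
    is the closed form for j - 1 moves and k - 1 ascents from d = 1. *)
Lemma moves_narayana j k : moves j k 0 = narayana j k.
Proof.
case: j k => [|j] [|k] //=.
  by rewrite big_nil.
rewrite big_nil addn0.
apply/eqP; rewrite -(eqn_pmul2r (ltn0Sn j)) -[_ %/ _]/(narayana j.+1 k.+1).
rewrite narayanaE //=; apply/eqP.
(* Multiplied by j.+1, both products of the determinant become multiples
   of 'C(j.+1, k.+1). *)
have := movesE j k 0; rewrite !addn0.
case: k => [|k] M; first by move: M; rewrite /= !bin0 !bin1; lia.
move: M; rewrite (_ : bin_pred j k.+1 = 'C(j, k)) // => M.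
have [jk|kj] := leqP j k.
  rewrite [X in _ = X * _]bin_small // mul0n; move: M.
  by rewrite [X in _ = X * _]bin_small //; lia.
have D1 := mul_bin_diag j.+1 k.+1; have D2 := mul_bin_down j.+1 k.+2.
have L := mul_bin_left j k; move: D1 D2; rewrite [_.-1]/=.
rewrite (binS j k) subSS => D1 D2.
apply/eqP; rewrite -(eqn_add2r ('C(j, k) * 'C(j, k.+2) * j.+1)) -mulnDl M.
have -> : 'C(j, k.+1) * 'C(j, k.+1) * j.+1
    = k.+2 * 'C(j.+1, k.+2) * 'C(j, k.+1).
  by rewrite -D1; lia.
have -> : 'C(j, k) * 'C(j, k.+2) * j.+1
    = (j - k.+1) * 'C(j.+1, k.+2) * 'C(j, k).
  by rewrite -D2; lia.
have -> : k.+2 * 'C(j.+1, k.+2) * 'C(j, k.+1)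
    = 'C(j.+1, k.+2) * ('C(j, k.+1) + (j - k) * 'C(j, k)).
  by rewrite -L; lia.
have -> : j - k = (j - k.+1).+1 by lia.
by apply/eqP; lia.
Qed.

(** For positive j, after multiplication by j, this is Vandermonde's identity
    for 'C(2 * j, j - 1). *)
Lemma sum_narayana j : \sum_(0 <= k < j.+1) narayana j k = catalan j.
Proof.
case: j => [|j]; first by rewrite big_nat1.
rewrite big_nat_recl //= add0n.
apply/eqP; rewrite -(eqn_pmul2r (ltn0Sn j)) big_distrl /=.
have -> : \sum_(0 <= k < j.+1) ('C(j.+1, k.+1) * 'C(j.+1, k)) %/ j.+1 * j.+1
  = 'C(j.+1 + j.+1, j).
  rewrite -Vandermonde big_mkord; apply: eq_bigr => k _.
  rewrite -[_ %/ _]/(narayana j.+1 k.+1) narayanaE //= mulnC; congr (_ * _).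
  by rewrite -bin_sub ?subSS //; exact: ltn_ord.
rewrite -(eqn_pmul2r (ltn0Sn j.+1)) mulnAC catalanE mul2n -addnn.
have := mul_bin_left (j.+1 + j.+1) j.
have -> : j.+1 + j.+1 - j = j.+2 by lia.
by move=> L; apply/eqP; rewrite [RHS]mulnC L mulnC.
Qed.

(** * Counting by the maximum *)

Lemma card_rgf_avoiding_max n k :
  #|[set w in rgf_avoiding n.+1 [:: 1; 2; 3; 2; 1]
       | maxletter (word w) == k.+1]|
  = \sum_(0 <= j < n.+1) 'C(n, j) * narayana j k.
Proof.
under eq_bigr => j _ do rewrite -moves_narayana.
have := count_continuations n k 1 0; rewrite addn0 => <-.
set A := [set w in _ | _].
(* The words counted are 1 followed by a continuation of the state (1, 1). *)
rewrite cardE -(size_map (@word n.+1)) -size_filter -[RHS](size_map (cons 1)).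
apply/perm_size/uniq_perm.
- by rewrite (map_inj_uniq (@word_inj _)) enum_uniq.
- by rewrite map_inj_uniq ?filter_uniq ?continuations_uniq // => s t [].
move=> r; apply/mapP/mapP => [[w]|[s]].
  rewrite mem_enum inE => /andP[wA mw] ->.
  have /and3P[sw R V] :=
    introT (rgf_avoidingP _ _ _) (ex_intro2 _ _ w wA erefl).
  have := rgf_avoids_12321 (word w); rewrite R V.
  case: (word w) sw mw {R V} => // x s /= ss mx /esym/andP[/eqP x1 g].
  rewrite x1 in mx *; exists s => //.
  rewrite mem_filter mem_continuations g (_ : size s == n) // !andbT.
  rewrite maxletter_foldl.
  by move: mx; rewrite /maxletter big_cons add1n.
rewrite mem_filter mem_continuations => /andP[ms /andP[ss g]] ->.
have /rgf_avoidingP[w wA ws] : [&& size (1 :: s) == n.+1, is_rgf (1 :: s)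
    & avoids (1 :: s) [:: 1; 2; 3; 2; 1]].
  by rewrite rgf_avoids_12321 /= g eqSS ss.
exists w; rewrite // mem_enum inE wA ws.
by rewrite /maxletter big_cons -/(maxletter s) -maxletter_foldl -add1n.
Qed.

Theorem corollary5p13 (n : nat) (n_ge1 : 1 <= n) :
  #|rgf_avoiding n.+1 [:: 1; 2; 3; 2; 1]|
    = \sum_(0 <= k < n.+1) 'C(n, k) * catalan k
  /\ (forall k : nat, k <= n ->
        #|[set w in rgf_avoiding n.+1 [:: 1; 2; 3; 2; 1]
             | maxletter (word w) == k.+1]|
          = \sum_(k <= j < n.+1) 'C(n, j) * narayana j k).
Proof.
have narayana0 j k : j < k -> narayana j k = 0.
  by case: k => // k jk; rewrite /= bin_small // mul0n div0n.
split=> [|k kn]; last first.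
  rewrite card_rgf_avoiding_max (big_cat_nat (leq0n k) (leqW kn)) /=.
  rewrite big_nat big1 ?add0n // => j /andP[_ jk].
  by rewrite narayana0 ?muln0.
set A := rgf_avoiding _ _.
(* The maximum of an RGF of length n + 1 lies between 1 and n + 1. *)
have -> : #|A|
    = \sum_(0 <= k < n.+1) #|[set w in A | maxletter (word w) == k.+1]|.
  under eq_bigr => k _ do rewrite -sum1_card.
  under eq_bigr => k _ do under eq_bigl => w do rewrite inE.
  under eq_bigr => k _ do rewrite big_mkcondr.
  rewrite exchange_big /= -sum1_card; apply: eq_bigr => w wA.
  have /and3P[/eqP sw R _] :=
    introT (rgf_avoidingP _ _ _) (ex_intro2 _ _ w wA erefl).
  have mn : maxletter (word w) <= n.+1.
    by rewrite maxletter_leq -{1}sw; apply/allP => x; apply: rgf_letter_le.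
  have m0 : 0 < maxletter (word w).
    rewrite ltnNge maxletter_leq; apply/negP => /allP H.
    case/and3P: R; case: (word w) sw H => // x s _ H /andP[x0 _] _ _.
    by have := H x (mem_head _ _); rewrite leqNgt x0.
  rewrite -big_mkcond /= big_mkord.
  have mi : (maxletter (word w)).-1 < n.+1 by lia.
  rewrite (big_pred1 (Ordinal mi)) // => i /=.
  by rewrite -val_eqE /=; lia.
under eq_bigr => k _ do rewrite card_rgf_avoiding_max.
rewrite exchange_big /=; apply: eq_big_nat => j /andP[_ jn].
rewrite -big_distrr /= -sum_narayana; congr (_ * _).
rewrite (big_cat_nat (leq0n j.+1) jn) /= [X in _ + X]big_nat.
by rewrite [X in _ + X]big1 ?addn0 // => k /andP[jk _]; apply: narayana0.
Qed.
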